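(* For $n\ge1$, $$|\Pi_n(1/234)|=\sum_{\ell=1}^{n}M(n-\ell)+\sum_{\ell=1}^{n-2}(n-\ell-1)\,M(n-\ell-1)+\sum_{\ell=1}^{n-3}\binom{n-\ell-1}{2}M(n-\ell-2),$$ where $M(m)=\sum_{k=0}^{\lfloor m/2\rfloor}\binom{m}{2k}(2k-1)!!$ is the number of set partitions of an $m$-element set into blocks of size at most $2$ (with $(-1)!!=1$).
   Context: The standardization of a set partition of a finite set $S\subset\mathbb{Z}_{>0}$ replaces the $i$-th smallest element of $S$ by $i$. A set partition $\pi$ of $[n]$ contains $\tau\vdash[k]$ if for some $S\subseteq[n]$ the standardization of the restriction of $\pi$ to $S$ is $\tau$; otherwise it avoids $\tau$. $\Pi_n(\tau)$ is the set of partitions of $[n]$ avoiding $\tau$. $1/234$ is the partition of $[4]$ with blocks $\{1\},\{2,3,4\}$. *)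

(* Defs.v *)
From mathcomp Require Import all_boot.

Set Implicit Arguments.
Unset Strict Implicit.
Unset Printing Implicit Defensive.

(** The set [n] = {1, ..., n} is represented by 'I_n = {0, ..., n - 1}, the
    number i of the mathematical text being the ordinal of value i - 1. *)

(** The 0-based position of [x] in the increasing enumeration of [S]. *)
Definition rank n (S : {set 'I_n}) (x : 'I_n) : nat :=
  #|[set y in S | y < x]|.

Definition restriction n (P : {set {set 'I_n}}) (S : {set 'I_n}) :
    {set {set 'I_n}} :=
  [set B :&: S | B in P] :\ set0.

(** Only meaningful when [Q] is a partition of [S] and [k = #|S|]. The size is
    a separate argument so that the result can be compared with a pattern on
    'I_k without a cast. *)
Definition standardization n k (S : {set 'I_n}) (Q : {set {set 'I_n}}) :
    {set {set 'I_k}} :=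
  [set [set i : 'I_k | [exists x in B, rank S x == i]] | B : {set 'I_n} in Q].

Definition contains n k (P : {set {set 'I_n}}) (tau : {set {set 'I_k}}) : bool :=
  [exists S : {set 'I_n},
    (#|S| == k) && (standardization k S (restriction P S) == tau)].

Definition avoiders n k (tau : {set {set 'I_k}}) : {set {set {set 'I_n}}} :=
  [set P | partition P [set: 'I_n] & ~~ contains P tau].

(** The partition 1/234 of [4]. *)
Definition pattern_1_234 : {set {set 'I_4}} :=
  [set [set inord 0]; [set inord 1; inord 2; inord 3]].

(** (2k - 1)!! = 1 * 3 * ... * (2k - 1), equal to 1 for k = 0. *)
Definition odd_double_fact (k : nat) : nat := \prod_(i < k) (2 * i + 1).

Definition M (m : nat) : nat :=
  \sum_(0 <= k < (m %/ 2).+1) 'C(m, 2 * k) * odd_double_fact k.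

Definition matching_partitions (T : finType) (A : {set T}) : {set {set {set T}}} :=
  [set P | partition P A & [forall B in P, #|B : {set T}| <= 2]].

(* Main.v *)
Require Import Defs.
From mathcomp Require Import all_boot zify.

(** Call the tail of a block the set of its elements lying above some
    non-element of the block. A partition avoids 1/234 iff every tail has at
    most 2 elements. A block that misses the least element is its own tail, so
    the condition says that the block of the least element is an initial segment
    of length l together with at most two elements beyond the first gap, and
    that the other blocks form a matching. Choosing l and the 0, 1 or 2
    additional elements gives the three sums. *)

Set Implicit Arguments.
Unset Strict Implicit.
Unset Printing Implicit Defensive.

(** * Matchings, counted through the block of a chosen element *)

Lemma M_widen m N : m < 2 * N ->
  M m = \sum_(k < N) 'C(m, 2 * k) * odd_double_fact k.
Proof.
move=> ltmN; have ltN : m %/ 2 < N by lia.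
rewrite /M big_mkord (big_ord_widen N (fun k => 'C(m, 2 * k) * odd_double_fact k)) //.
rewrite big_mkcond; apply: eq_bigr => k _; case: leqP => // ltk.
by rewrite bin_small //; lia.
Qed.

(** Pascal's rule splits each ['C(m.+2, 2k+2)] in two. One half rebuilds [M m.+1]; the other gives
    [m.+1 * M m], because [(2k+1) * 'C(m.+1, 2k+1) = m.+1 * 'C(m, 2k)] absorbs the last factor of
    [(2k+1)!!]. *)
Lemma M_rec m : M m.+2 = M m.+1 + m.+1 * M m.
Proof.
rewrite (@M_widen m.+2 m.+2) ?(@M_widen m.+1 m.+2) ?(@M_widen m m.+1); try lia.
rewrite !(big_ord_recl m.+1) !bin0 -addnA; congr (_ + _).
rewrite big_distrr /= -big_split; apply: eq_bigr => k _ /=.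
rewrite /bump /= add1n mulnS add2n binS mulnDl; congr (_ + _).
rewrite /odd_double_fact big_ord_recr /= [RHS]mulnA mul_bin_diag.
by rewrite -/(odd_double_fact k) addn1; lia.
Qed.

Lemma sum_bounded_subsets (T : finType) (A : {set T}) k (F : nat -> nat) :
  \sum_(S : {set T} | (S \subset A) && (#|S| <= k)) F #|S| =
  \sum_(i < k.+1) 'C(#|A|, i) * F i.
Proof.
rewrite (partition_big (fun S : {set T} => inord #|S| : 'I_k.+1) xpredT) //=.
apply: eq_bigr => i _; rewrite -cards_draws -sum1dep_card big_distrl /=.
under [RHS]eq_bigr => S /andP[_ /eqP<-] do rewrite mul1n.
apply: eq_bigl => S; rewrite -andbA; congr (_ && _).
case: leqP => /= [leSk | ltkS]; first by rewrite -val_eqE /= inordK.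
(* Beyond the bound [k] both sides are false, whatever default [inord] returns. *)
by apply/esym/eqP => eqS; move: (ltn_ord i); lia.
Qed.

(** Removing the block [B] of [x] leaves an arbitrary partition of [A :\: B] into blocks satisfying
    [h]. This serves both for matchings and, with [h] a bound on tails, for the avoiders. *)
Lemma card_partition_all (T : finType) (A : {set T}) x (h : pred {set T}) : x \in A ->
  #|[set P | partition P A & [forall C in P, h C]]| =
  \sum_(B : {set T} | [&& x \in B, B \subset A & h B])
    #|[set P | partition P (A :\: B) & [forall C in P, h C]]|.
Proof.
move=> Ax; rewrite -sum1dep_card.
rewrite (partition_big (fun P => pblock P x)
  (fun B : {set T} => [&& x \in B, B \subset A & h B])) /=; last first.
  move=> P /andP[partP /forall_inP hP].
  have Px : x \in cover P by rewrite (cover_partition partP).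
  rewrite mem_pblock Px hP ?pblock_mem // andbT.
  by rewrite -(cover_partition partP) /cover (bigcup_sup (pblock P x)) ?pblock_mem.
apply: eq_bigr => B /and3P[Bx sBA hB]; rewrite -sum1dep_card.
rewrite (reindex_onto (fun P => B |: P) (fun P => P :\ B)) /=; last first.
  move=> P /andP[/andP[partP _] /eqP defB]; apply: setD1K.
  by rewrite -defB pblock_mem // (cover_partition partP).
apply: eq_bigl => P; apply/idP/idP.
  case/andP=> /andP[/andP[partBP /forall_inP hBP] _] /eqP defP.
  have BBP : B \in B |: P by rewrite setU11.
  rewrite -{1}defP partitionD1 //=; apply/forall_inP => C PC.
  by rewrite hBP // setU1r.
case/andP=> partP /forall_inP hP.
(* [P] covers only [A :\: B], which misses [x], so adding [B] really adds a block and can be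
   undone. *)
have B'P : B \notin P.
  apply/negP=> PB; have : x \in A :\: B.
    by rewrite -(cover_partition partP); apply/bigcupP; exists B.
  by rewrite inE Bx.
have partBP : partition (B |: P) A.
  rewrite -(setID A B) (setIidPr sBA); apply: partitionU1 => //.
    by apply/set0Pn; exists x.
  by rewrite disjoint_sym disjoints_subset setDE subsetIr.
rewrite partBP setU1K // eqxx andbT /=.
rewrite (@def_pblock _ _ B) ?setU11 ?(partition_trivIset partBP) // eqxx andbT.
by apply/forall_inP => C /setU1P[-> // | /hP].
Qed.

(** Strong induction on [#|A|]: the block of [x] is [x |: S] with [S] empty or a singleton of
    [A :\ x], which reproduces the recurrence [M_rec]. *)
Lemma card_matching_partitions (T : finType) (A : {set T}) :
  #|matching_partitions A| = M #|A|.
Proof.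
have [m] := ubnP #|A|; elim: m A => // m IHm A ltAm.
have [-> | /set0Pn[x Ax]] := eqVneq A set0.
  rewrite cards0 /M big_nat1 bin0 /odd_double_fact big_ord0 mul1n.
  rewrite -(cards1 (set0 : {set {set T}})); apply: eq_card => P.
  rewrite !inE partition_set0; apply: andb_idr => /eqP->.
  by apply/forall_inP => B; rewrite inE.
rewrite /matching_partitions (card_partition_all _ Ax).
rewrite (reindex_onto (fun S => x |: S) (fun B => B :\ x)) /=; last first.
  by move=> B /andP[/setD1K].
have cardA := cardsD1 x A; rewrite Ax in cardA.
transitivity (\sum_(S : {set T} | (S \subset A :\ x) && (#|S| <= 1))
    M (#|A :\ x| - #|S|)).
  apply: eq_big => [S | S /andP[/and3P[_ sSA _] /eqP defS]].
    rewrite setU11 subUset sub1set Ax /= subsetD1.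
    case: (boolP (x \in S)) => [Sx | S'x].
      rewrite andbF; apply/negbTE/negP=> /andP[_ /eqP defS].
      by rewrite -defS setD11 in Sx.
    by rewrite setU1K // eqxx /= !andbT cardsU1 S'x.
  have S'x : x \notin S by rewrite -defS setD11.
  have le1 : 0 < #|x |: S| by rewrite cardsU1 S'x.
  rewrite [LHS]IHm cardsD (setIidPr sSA) ?cardsU1 ?S'x ?cardA //; last by lia.
rewrite (sum_bounded_subsets _ _ (fun i => M (#|A :\ x| - i))).
rewrite !big_ord_recr big_ord0 /= bin0 bin1 cardA subn0 add0n mul1n.
(* [M_rec] starts at two elements; for a single element the pairing term has factor 0 and both
   values of [M] are computed. *)
by case: #|A :\ x| => [|p]; rewrite ?subn1 ?M_rec // mul0n addn0 /M !big_nat1 !bin0.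
Qed.

(** * Containment of 1/234 expressed by tails *)

Definition tail n (B : {set 'I_n}) : {set 'I_n} :=
  [set x in B | [exists a : 'I_n, (a < x) && (a \notin B)]].

Lemma rank_lt n (S : {set 'I_n}) (x y : 'I_n) : rank S x < rank S y -> x < y.
Proof.
rewrite !ltnNge; apply: contra => leyx; apply: subset_leq_card.
by apply/subsetP => z; rewrite !inE => /andP[-> /leq_trans->].
Qed.

Lemma contains_pattern_order n (P : {set {set 'I_n}}) :
  contains P pattern_1_234 -> exists2 B, B \in P &
    exists a b c d : 'I_n, [/\ a \notin B, [/\ b \in B, c \in B & d \in B]
                             & [&& a < b, b < c & c < d]].
Proof.
case/existsP=> S /andP[_ /eqP defQ].
have inQ X : X \in pattern_1_234 -> exists2 B, B \in P &
    X = [set i : 'I_4 | [exists x in B :&: S, rank S x == i]].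
  by rewrite -defQ => /imsetP[_ /setD1P[_ /imsetP[B PB ->]] ->]; exists B.
have [|B1 PB1 defB1] := inQ [set inord 0]; first by rewrite !inE eqxx.
have [|B2 PB2 defB2] := inQ [set inord 1; inord 2; inord 3].
  by rewrite !inE eqxx orbT.
have getB2 (i : 'I_4) : i \in [set inord 1; inord 2; inord 3] ->
    exists2 x, (x \in B2) && (x \in S) & rank S x = i.
  by rewrite defB2 inE => /exists_inP[x /setIP[Bx Sx] /eqP eqi];
    exists x => //; rewrite Bx.
have : inord 0 \in [set inord 0 : 'I_4] by rewrite inE.
rewrite defB1 inE => /exists_inP[a /setIP[_ Sa] /eqP ra].
have [|b /andP[Bb _] rb] := getB2 (inord 1); first by rewrite !inE eqxx.
have [|c /andP[Bc _] rc] := getB2 (inord 2); first by rewrite !inE eqxx orbT.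
have [|d /andP[Bd _] rd] := getB2 (inord 3); first by rewrite !inE eqxx !orbT.
exists B2 => //; exists a, b, c, d; split=> //.
  (* If [a] were in [B2], its rank 0 would belong to the standardized block, which is {1, 2, 3}. *)
  apply/negP=> B2a.
  suff : inord 0 \in [set inord 1; inord 2; inord 3 : 'I_4].
    by rewrite !inE -!val_eqE /= !inordK.
  by rewrite defB2 inE; apply/exists_inP; exists a; rewrite ?inE ?B2a ?ra.
by rewrite !(@rank_lt _ S) // ?ra ?rb ?rc ?rd !inordK.
Qed.

(** The set [S] of the four points is the witness: their ranks are 0, 1, 2, 3, and [P] cuts [S] into
    the singleton of [a] and the three points of [B]. *)
Lemma order_contains_pattern n (P : {set {set 'I_n}}) B (a b c d : 'I_n) :
  partition P setT -> B \in P -> a \notin B -> b \in B -> c \in B -> d \in B ->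
  a < b -> b < c -> c < d -> contains P pattern_1_234.
Proof.
move=> partP PB B'a Bb Bc Bd ltab ltbc ltcd.
pose S := [set a; b; c; d]; apply/existsP; exists S.
have nab : a != b by rewrite -val_eqE /=; lia.
have nac : a != c by rewrite -val_eqE /=; lia.
have nad : a != d by rewrite -val_eqE /=; lia.
have nbc : b != c by rewrite -val_eqE /=; lia.
have nbd : b != d by rewrite -val_eqE /=; lia.
have ncd : c != d by rewrite -val_eqE /=; lia.
have ra : rank S a = 0.
  by apply/eqP; rewrite cards_eq0; apply/eqP/setP=> x; rewrite !inE -!val_eqE /=; lia.
have rb : rank S b = 1.
  rewrite /rank -(cards1 a); congr #|pred_of_set _|.
  by apply/setP=> x; rewrite !inE -!val_eqE /=; lia.
have rc : rank S c = 2.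
  have := cards2 a b; rewrite nab => <-; congr #|pred_of_set _|.
  by apply/setP=> x; rewrite !inE -!val_eqE /=; lia.
have rd : rank S d = 3.
  transitivity #|c |: [set a; b]|; last first.
    by rewrite cardsU1 cards2 !inE nab -!val_eqE /=; lia.
  congr #|pred_of_set _|; apply/setP=> x; rewrite !inE -!val_eqE /=; lia.
have -> : #|S| == 4.
  by rewrite /S setUC cardsU1 setUC cardsU1 cards2 !inE nab -!val_eqE /=; lia.
have Pa : a \in cover P by rewrite (cover_partition partP) inE.
have defBS : B :&: S = [set b; c; d].
  apply/setP=> x; rewrite !inE; have [->|_] := eqVneq x a.
    by rewrite (negbTE B'a) (negbTE nab) (negbTE nac) (negbTE nad).
  by apply: andb_idl => /orP[/orP[]|] /eqP->.
have aloneS C : C \in P -> a \in C -> C :&: S = [set a].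
  move=> PC Ca; have nBC : C != B by apply: contraNneq B'a => <-.
  have disjBC x : x \in B -> x \notin C.
    have /trivIsetP/(_ _ _ PC PB nBC) := partition_trivIset partP.
    by rewrite disjoint_sym => /disjointFr BC /BC ->.
  apply/setP=> x; rewrite !inE; have [->|_] := eqVneq x a; first by rewrite Ca.
  apply/negbTE; rewrite negb_and -implyNb negbK; apply/implyP => Cx.
  by apply/negP => /orP[/orP[]|] /eqP eqx; move: Cx; apply/negP/disjBC; rewrite eqx.
have -> : restriction P S = [set [set a]; [set b; c; d]].
  apply/setP=> X; rewrite !inE; apply/andP/orP; last first.
    case=> /eqP->; split; try by apply/set0Pn; [exists a + exists b]; rewrite !inE eqxx.
      apply/imsetP; exists (pblock P a); rewrite ?pblock_mem // aloneS //.
        by rewrite pblock_mem.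
      by rewrite mem_pblock.
    by apply/imsetP; exists B.
  case=> /set0Pn[x Xx] /imsetP[C PC defX]; rewrite {X}defX in Xx *.
  have [Ca | C'a] := boolP (a \in C); first by rewrite aloneS //; left.
  (* A block that meets [S] but avoids [a] contains one of [b], [c], [d], hence is [B] by
     disjointness. *)
  right; rewrite -defBS; apply/eqP; congr (_ :&: _).
  have /setIP[Cx Sx] := Xx.
  have Bx : x \in B.
    move: Sx; rewrite !inE => /orP[/orP[/orP[]|]|] /eqP eqx; rewrite eqx //.
    by rewrite -eqx Cx in C'a.
  have tiP := partition_trivIset partP.
  by rewrite -(def_pblock tiP PC Cx) (def_pblock tiP PB Bx).
rewrite /standardization imsetU1 imset_set1 /pattern_1_234 /=; apply/eqP.
congr ([set _; _]); apply/setP=> i; rewrite !inE -?val_eqE /= !inordK //.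
  apply/exists_inP/eqP => [[x /set1P->] | ->]; first by rewrite ra => /eqP<-.
  by exists a; rewrite ?inE ?ra.
apply/exists_inP/idP => [[x] | ].
  by rewrite !inE => /orP[/orP[]|] /eqP->; rewrite ?rb ?rc ?rd eq_sym => ->; rewrite ?orbT.
by case/orP=> [/orP[]|] /eqP->; [exists b | exists c | exists d];
  rewrite ?rb ?rc ?rd // !inE eqxx ?orbT.
Qed.

Lemma contains_patternE n (P : {set {set 'I_n}}) : partition P setT ->
  contains P pattern_1_234 = [exists B in P, 2 < #|tail B|].
Proof.
move=> partP; apply/idP/exists_inP.
  case/contains_pattern_order=> B PB [a [b [c [d [B'a [Bb Bc Bd] /and3P[lab lbc lcd]]]]]].
  have inT x : x \in B -> a < x -> x \in tail B.
    by move=> Bx lax; rewrite inE Bx; apply/existsP; exists a; rewrite lax.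
  exists B => //; apply/card_gt2P; exists b, c, d; split; first by split; apply: inT => //; lia.
  by split; rewrite -val_eqE /=; lia.
case=> B PB /card_gt2P[x [y [z [[Tx Ty Tz] [nxy nyz nzx]]]]].
(* Once the three tail elements are sorted, the non-element below the smallest one lies below all
   three. *)
suff [b [c [d [Tb Tc Td /andP[lbc lcd]]]]] : exists b c d : 'I_n,
    [/\ b \in tail B, c \in tail B, d \in tail B & b < c < d].
  move: Tb Tc Td; rewrite !inE => /andP[Bb /existsP[a /andP[lab B'a]]] /andP[Bc _] /andP[Bd _].
  exact: (order_contains_pattern partP PB B'a Bb Bc Bd).
move: nxy nyz nzx; rewrite -!val_eqE /= => nxy nyz nzx.
case: (ltngtP x y) nxy => // lxy _; case: (ltngtP y z) nyz => // lyz _;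
  case: (ltngtP z x) nzx => // lzx _; try lia;
  by [exists x, y, z; split; rewrite // lxy | exists x, z, y; split; rewrite // lzx
    | exists y, x, z; split; rewrite // lxy | exists y, z, x; split; rewrite // lyz
    | exists z, x, y; split; rewrite // lzx | exists z, y, x; split; rewrite // lyz].
Qed.

(** * Sets containing the least element, sorted by first gap and tail *)

(** The least non-element of [B], or [n] if there is none. *)
Definition first_gap n (B : {set 'I_n}) : nat :=
  find (fun i => i \notin B) (enum 'I_n).

Definition below n l : {set 'I_n} := [set i : 'I_n | i < l].
(** The index [l] lies in neither [below n l] nor [above n l]: it is the place of the gap. *)
Definition above n l : {set 'I_n} := [set i : 'I_n | l < i].

Lemma card_below n l : l <= n -> #|below n l| = l.
Proof.
by move=> leln; rewrite -sum1dep_card -(big_ord_widen _ (fun=> 1) leln) sum1_card card_ord.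
Qed.

Lemma card_above n l : #|above n l| = n - l.+1.
Proof.
have [ltln | lenl] := ltnP l n; last first.
  by rewrite (_ : above n l = set0) ?cards0; [lia|];
    apply/setP=> i; rewrite !inE; have := ltn_ord i; lia.
rewrite cardsCs card_ord -[in RHS](card_below ltln); congr (_ - #|pred_of_set _|).
by apply/setP=> i; rewrite !inE; lia.
Qed.

Lemma first_gap_leq n (B : {set 'I_n}) : first_gap B <= n.
Proof. by rewrite -[leqRHS](size_enum_ord n) find_size. Qed.

(** Quantifying over the [i] of value [l] makes the second condition vacuous when [l = n], the case
    without a gap. *)
Lemma first_gapP n (B : {set 'I_n}) l : l <= n ->
  reflect ((forall i : 'I_n, i < l -> i \in B) /\ (forall i : 'I_n, i = l :> nat -> i \notin B))
          (first_gap B == l).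
Proof.
move=> leln.
have gapB (i : 'I_n) : i < first_gap B -> i \in B.
  by move/(before_find i); rewrite nth_ord_enum => /negbFE.
have gapB' (i : 'I_n) : i = first_gap B :> nat -> i \notin B.
  move=> eqi; have : has (fun i => i \notin B) (enum 'I_n).
    by rewrite has_find size_enum_ord -/(first_gap B) -eqi.
  by move/(nth_find i); rewrite -/(first_gap B) -eqi nth_ord_enum.
apply: (iffP eqP) => [<- // | [inB notinB]].
case: (ltngtP (first_gap B) l) => // [lt_gl | lt_lg].
  have ltn := leq_trans lt_gl leln.
  by have := gapB' (Ordinal ltn) erefl; rewrite inB.
have ltn := leq_trans lt_lg (first_gap_leq B).
by have := gapB (Ordinal ltn) lt_lg; rewrite (negbTE (notinB _ _)).
Qed.

(** Nothing is missing below an element of the initial segment, while every element of [S] lies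
    above the missing index [l]. *)
Lemma tail_below n l (S : {set 'I_n}) : S \subset above n l ->
  tail (below n l :|: S) = S.
Proof.
move=> /subsetP sS; apply/setP=> x; rewrite !inE; apply/andP/idP.
  case=> /orP[ltxl | //] /existsP[a /andP[ltax]].
  by rewrite !inE (ltn_trans ltax ltxl).
move=> Sx; rewrite Sx orbT; split=> //; apply/existsP.
have := sS x Sx; rewrite inE => ltlx.
exists (Ordinal (ltn_trans ltlx (ltn_ord x))); rewrite ltlx !inE ltnn /=.
by apply/negP=> /sS; rewrite inE ltnn.
Qed.

(** [B] is determined by its first gap [l >= 1] and its tail, which may be any subset of
    [above n.+1 l] with at most [k] elements; then [#|B|] is [l] plus the size of the tail. The
    value [l = n.+1] accounts for the full set. *)
Lemma sum_by_tail n k (F : nat -> nat) :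
  \sum_(B : {set 'I_n.+1} | (ord0 \in B) && (#|tail B| <= k)) F #|B| =
  \sum_(1 <= l < n.+2) \sum_(i < k.+1) 'C(n.+1 - l.+1, i) * F (l + i).
Proof.
rewrite big_geq_mkord /=.
rewrite (partition_big (fun B => inord (first_gap B) : 'I_n.+2)
                       (fun l : 'I_n.+2 => 0 < l)) /=; last first.
  move=> B /andP[B0 _]; rewrite inordK ?ltnS ?first_gap_leq // lt0n.
  by apply/negP=> /first_gapP[// | _ /(_ ord0 erefl)]; rewrite B0.
apply: eq_bigr => l l_gt0; have leln : l <= n.+1 by rewrite -ltnS.
under [LHS]eq_bigl => B do rewrite -val_eqE /= inordK ?ltnS ?first_gap_leq //.
rewrite -(card_above n.+1 l) -(sum_bounded_subsets _ _ (fun i => F (l + i))).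
rewrite (reindex_onto (fun S => below n.+1 l :|: S) (fun B => B :&: above n.+1 l)) /=.
  apply: eq_big => [S | S /andP[_ /eqP defS]]; last first.
    rewrite cardsU card_below // (_ : _ :&: _ = set0) ?cards0 ?subn0 //.
    by apply/setP=> x; rewrite -defS !inE; lia.
  have [sS | not_sS] /= := boolP (S \subset above n.+1 l); last first.
    by apply: contraNF not_sS => /andP[_ /eqP <-]; exact: subsetIr.
  rewrite tail_below // !inE /= l_gt0 /= -andbA.
  have -> : first_gap (below n.+1 l :|: S) == l.
    apply/first_gapP => //; split=> i; rewrite !inE => eqil; first by rewrite eqil.
    by rewrite eqil ltnn; apply/negP=> /(subsetP sS); rewrite inE eqil ltnn.
  have -> : (below n.+1 l :|: S) :&: above n.+1 l = S.
    rewrite setIUl (setIidPl sS) (_ : _ :&: _ = set0) ?set0U //.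
    by apply/setP=> x; rewrite !inE; lia.
  by rewrite eqxx !andbT.
move=> B /andP[_ /first_gapP[// | inB notinB]]; apply/setP=> x; rewrite !inE.
by case: (ltngtP x l) => [/inB -> | _ | /notinB/negbTE->]; rewrite ?andbT ?andbF.
Qed.

Lemma tail_without0 n (B : {set 'I_n.+1}) : ord0 \notin B -> tail B = B.
Proof.
move=> B'0; apply/setP=> x; rewrite inE; apply: andb_idr => Bx.
apply/existsP; exists ord0; rewrite B'0 andbT lt0n.
by apply: contraNneq B'0 => x0; rewrite (_ : ord0 = x) //; apply: val_inj.
Qed.

(** * Assembling the count of avoiders *)

Lemma sum_nat_vanishing (F : nat -> nat) m p q : m <= p <= q ->
    (forall l, p <= l < q -> F l = 0) ->
  \sum_(m <= l < q) F l = \sum_(m <= l < p) F l.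
Proof.
case/andP=> lemp lepq F0; rewrite (big_cat_nat (n := p)) //=.
by rewrite [X in _ + X]big_nat_cond [X in _ + X]big1 ?addn0 // => l /andP[/F0].
Qed.

Theorem theorem4p11 (n : nat) (hn : 1 <= n) :
  #|avoiders n pattern_1_234| =
      \sum_(1 <= l < n.+1) M (n - l)
    + \sum_(1 <= l < (n - 2).+1) (n - l - 1) * M (n - l - 1)
    + \sum_(1 <= l < (n - 3).+1) 'C(n - l - 1, 2) * M (n - l - 2)
  /\ (forall (T : finType) (A : {set T}), #|matching_partitions A| = M #|A|).
Proof.
split; last exact: card_matching_partitions.
case: n hn => // n _.
transitivity #|[set P | partition P [set: 'I_n.+1] & [forall B in P, #|tail B| <= 2]]|.
  congr #|pred_of_set _|; apply/setP=> P; rewrite !inE.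
  apply: andb_id2l => partP; rewrite contains_patternE // negb_exists_in.
  by apply: eq_forallb => B; rewrite -leqNgt.
rewrite (card_partition_all _ (in_setT ord0)).
transitivity (\sum_(B : {set 'I_n.+1} | (ord0 \in B) && (#|tail B| <= 2)) M (n.+1 - #|B|)).
  apply: eq_big => [B | B /and3P[B0 _ _]]; first by rewrite subsetT.
  have -> : n.+1 - #|B| = #|~: B| by rewrite [RHS]cardsCs setCK card_ord.
  rewrite setTD -card_matching_partitions; congr #|pred_of_set _|; apply/setP=> P.
  rewrite !inE; apply: andb_id2l => partP; apply: eq_forallb_in => C PC.
  (* The remaining blocks miss [ord0], so bounding their tails by 2 bounds the blocks themselves:
     they form a matching of the complement of [B]. *)
  rewrite tail_without0 //; apply: contraL B0 => C0; rewrite -in_setC.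
  by rewrite -(cover_partition partP); apply/bigcupP; exists C.
rewrite (@sum_by_tail _ 2 (fun i => M (n.+1 - i))).
(* The second and third sums are extended to the range of the first; the added terms vanish because
   their coefficients [n.+1 - l - 1] and ['C(n.+1 - l - 1, 2)] are 0 there. *)
rewrite -(@sum_nat_vanishing (fun l => _ * _) 1 _ n.+2); [| lia |]; last first.
  by move=> l ltl; rewrite (_ : n.+1 - l - 1 = 0) //; lia.
rewrite -(@sum_nat_vanishing (fun l => 'C(_, 2) * _) 1 _ n.+2); [| lia |]; last first.
  by move=> l ltl; rewrite bin_small //; lia.
rewrite -!big_split; apply: eq_bigr => l _ /=.
(* Tail sizes 0, 1 and 2 give the summands of the three sums in turn. *)
rewrite !big_ord_recr big_ord0 /= bin0 bin1 add0n mul1n.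
by congr (M _ + _ * M _ + 'C(_, 2) * M _); lia.
Qed.
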